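(* Let $\mathbb{F}$, $\mathfrak g$, $\mathcal C$, $\mathcal C^{du}$, $M$, $Lie(M)$ be as in the context. Let $x\in Lie(M)$ be locally finite, and suppose that for every object $V$ of $\mathcal C$ the semisimple part $s_V$ and the locally nilpotent part $n_V$ of the additive Jordan–Chevalley decomposition of $x_V$ lie in $End_{V^{du}}(V)$. Put $s=(s_V)_V$ and $n=(n_V)_V$. Then $s$ is a semisimple element of $Lie(M)$, $n$ is a locally nilpotent element of $Lie(M)$, $x=s+n$ and $[s,n]=0$, and $s,n$ are uniquely determined by these properties.
   Context: Let $\mathbb F$ be a field of characteristic $0$, $\mathfrak g$ a Lie algebra over $\mathbb F$. $\mathcal C$: full subcategory of $\mathfrak g$-modules closed under isomorphism and submodules, containing a direct sum and tensor product of any two objects and a one-dimensional trivial module, with only $0\in\mathfrak g$ acting trivially on all objects. $x_V$ = action. Category of duals: point-separating $V^{du}\subseteq V^*$ with $\phi\circ x_V\in V^{du}$ ($x\in\mathfrak g$), $\psi\circ\alpha\in V^{du}$ for morphisms $\alpha:V\to W$, $\psi\in W^{du}$, $(V\oplus W)^{du}=V^{du}\oplus W^{du}$, $V^{du}\otimes W^{du}\subseteq(V\otimes W)^{du}$. $End_{V^{du}}(V)=\{\varphi:\phi\circ\varphi\in V^{du}\ \forall\phi\}$. $Nat$: families $(m_V)_V$, $m_V\in End_{V^{du}}(V)$, commuting with all morphisms. $M=\{m\in Nat:m_{V\otimes W}=m_V\otimes m_W,\ m_{V_0}=id$ for trivial one-dimensional $V_0\}$; $\mathbb F[M]=\{f_{\phi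 v}\}$, $f_{\phi v}(m)=\phi(m_Vv)$. $Lie(M)=\{x\in Nat:x_{V\otimes W}=x_V\otimes id+id\otimes x_W,\ x_{V_0}=0,\ \exists\,\delta_x:\mathbb F[M]\to\mathbb F$ with $\delta_x(f_{\phi v})=\phi(x_Vv)\}$, a Lie subalgebra of $Nat$. An endomorphism $y$ of a vector space $V$ is locally finite if every $v$ lies in a finite-dimensional $y$-invariant subspace; semisimple if it is locally finite and its extension to $V\otimes_{\mathbb F}\overline{\mathbb F}$ is diagonalizable; locally nilpotent if each $v$ is killed by some power of $y$. Every locally finite $y$ has a unique decomposition $y=s+n$ with $s$ semisimple, $n$ locally nilpotent, $[s,n]=0$ (additive Jordan–Chevalley decomposition). An element of $Lie(M)$ is called locally finite / semisimple / locally nilpotent if it acts so on every object of $\mathcal C$. *)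

(* Defs.v *)
From HB Require Import structures.
From mathcomp Require Import all_boot all_order all_algebra.
Set Implicit Arguments. Unset Strict Implicit. Unset Printing Implicit Defensive.
Import GRing.Theory.
Local Open Scope ring_scope.

Section LieDefs.
Variable F : fieldType.

Definition lin (V W : lmodType F) (f : V -> W) : Prop :=
  forall (a : F) (u v : V), f (a *: u + v) = a *: f u + f v.

Definition lfun (V : lmodType F) (phi : V -> F) : Prop :=
  forall (a : F) (u v : V), phi (a *: u + v) = a * phi u + phi v.

Definition bilin (V W Z : lmodType F) (b : V -> W -> Z) : Prop :=
  (forall w, lin (fun v => b v w)) /\ (forall v, lin (b v)).

Definition in_span (V : lmodType F) (n : nat) (vs : 'I_n -> V) (u : V) : Prop :=
  exists c : 'I_n -> F, u = \sum_(i < n) c i *: vs i.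

Definition lin_indep (V : lmodType F) (n : nat) (vs : 'I_n -> V) : Prop :=
  forall c : 'I_n -> F, \sum_(i < n) c i *: vs i = 0 -> forall i, c i = 0.

Definition span_invariant (V : lmodType F) (y : V -> V) (n : nat) (vs : 'I_n -> V) :=
  forall i, in_span vs (y (vs i)).

Definition locally_finite (V : lmodType F) (y : V -> V) : Prop :=
  forall v : V, exists n (vs : 'I_n -> V), span_invariant y vs /\ in_span vs v.

Definition locally_nilpotent (V : lmodType F) (y : V -> V) : Prop :=
  forall v : V, exists k : nat, iter k y v = 0.

(* y semisimple, relative to an algebraic closure iota : F -> L:
   y is locally finite and its extension to V (x)_F L is diagonalizable, i.e.
   on every finite-dimensional y-invariant subspace (given by a basis vs, y acting
   by the matrix A w.r.t. vs) the extension of scalars of y|_W is diagonalizable. *)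
Definition semisimple_op (L : fieldType) (iota : {rmorphism F -> L})
    (V : lmodType F) (y : V -> V) : Prop :=
  locally_finite y /\
  forall (n : nat) (vs : 'I_n -> V) (A : 'M[F]_n),
    lin_indep vs ->
    (forall i, y (vs i) = \sum_(j < n) A i j *: vs j) ->
    diagonalizable (map_mx iota A).

Definition JC_decomp (L : fieldType) (iota : {rmorphism F -> L})
    (V : lmodType F) (y s n : V -> V) : Prop :=
  [/\ semisimple_op iota s, locally_nilpotent n,
      (forall v, s (n v) = n (s v)) & (forall v, y v = s v + n v)].

Definition lie_bracket (g : lmodType F) (br : g -> g -> g) : Prop :=
  [/\ bilin br, (forall x, br x x = 0) &
      (forall x y z, br x (br y z) + br y (br z x) + br z (br x y) = 0)].

Variables (g : lmodType F) (br : g -> g -> g).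

Record gmod := GMod {
  gcar :> lmodType F;
  gact : g -> gcar -> gcar;
  gact_bilin : bilin gact;
  gact_br : forall x y v, gact (br x y) v = gact x (gact y v) - gact y (gact x v)
}.
Arguments gact : clear implicits.

Definition gmor (V W : gmod) (f : V -> W) : Prop :=
  lin f /\ forall x v, f (gact V x v) = gact W x (f v).

Definition gmod_iso (V W : gmod) : Prop :=
  exists (f : V -> W) (h : W -> V), [/\ gmor f, gmor h, cancel f h & cancel h f].

Definition is_dsum (V W S : gmod) (i1 : V -> S) (i2 : W -> S) (p1 : S -> V) (p2 : S -> W)
  : Prop :=
  [/\ gmor i1 /\ gmor i2, gmor p1 /\ gmor p2,
      [/\ cancel i1 p1, cancel i2 p2, (forall v, p2 (i1 v) = 0) & (forall w, p1 (i2 w) = 0)]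
    & forall s, s = i1 (p1 s) + i2 (p2 s)].

Definition is_tensor (V W T : gmod) (b : V -> W -> T) : Prop :=
  [/\ bilin b,
      (forall x v w, gact T x (b v w) = b (gact V x v) w + b v (gact W x w)) &
      forall (Z : lmodType F) (beta : V -> W -> Z), bilin beta ->
        exists f : T -> Z, [/\ lin f, (forall v w, f (b v w) = beta v w) &
           forall f' : T -> Z, lin f' -> (forall v w, f' (b v w) = beta v w) ->
             forall t, f' t = f t]].

Definition trivial1 (V : gmod) : Prop :=
  (exists e : V, e != 0 /\ forall v : V, exists a : F, v = a *: e) /\
  (forall x v, gact V x v = 0).

Definition good_cat (C : gmod -> Prop) : Prop :=
  [/\ (forall V W : gmod, C V -> gmod_iso V W -> C W),
      (forall (V W : gmod) (f : W -> V), C V -> gmor f -> injective f -> C W),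
      (forall V W : gmod, C V -> C W ->
         exists S, C S /\ exists i1 i2 p1 p2, @is_dsum V W S i1 i2 p1 p2),
      (forall V W : gmod, C V -> C W -> exists T, C T /\ exists b, @is_tensor V W T b)
      /\ (exists V0, C V0 /\ trivial1 V0)
    & (forall x, (forall V : gmod, C V -> forall v : V, gact V x v = 0) -> x = 0)].

Definition dual_cat (C : gmod -> Prop) (du : forall V : gmod, (V -> F) -> Prop) : Prop :=
  [/\ (forall V : gmod, C V ->
         [/\ (forall phi, du V phi -> lfun phi),
             du V (fun _ => 0),
             (forall a phi psi, du V phi -> du V psi ->
                 du V (fun v => a * phi v + psi v))
           & (forall v : V, v != 0 -> exists phi, du V phi /\ phi v != 0)]),
      (forall V : gmod, C V -> forall x phi, du V phi -> du V (fun v => phi (gact V x v))),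
      (forall (V W : gmod) (alpha : V -> W) psi, C V -> C W -> gmor alpha -> du W psi ->
          du V (fun v => psi (alpha v))),
      (forall (V W S : gmod) i1 i2 p1 p2, C V -> C W -> C S -> @is_dsum V W S i1 i2 p1 p2 ->
          forall phi, lfun phi ->
            du S phi <-> (du V (fun v => phi (i1 v)) /\ du W (fun w => phi (i2 w))))
    & (forall (V W T : gmod) b, C V -> C W -> C T -> @is_tensor V W T b ->
          forall phi psi chi, du V phi -> du W psi -> lfun chi ->
            (forall v w, chi (b v w) = phi v * psi w) -> du T chi)].

(* families of maps indexed by the objects (only the values on objects of C matter) *)
Definition gfamily := forall V : gmod, V -> V.

Definition End_du (du : forall V : gmod, (V -> F) -> Prop) (V : gmod) (f : V -> V) : Prop :=
  lin f /\ forall phi, du V phi -> du V (fun v => phi (f v)).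

Definition in_Nat (C : gmod -> Prop) du (m : gfamily) : Prop :=
  (forall V : gmod, C V -> End_du du (m V)) /\
  (forall (V W : gmod) (f : V -> W), C V -> C W -> gmor f -> forall v, f (m V v) = m W (f v)).

Definition in_M (C : gmod -> Prop) du (m : gfamily) : Prop :=
  [/\ in_Nat C du m,
      (forall (V W T : gmod) b, C V -> C W -> C T -> @is_tensor V W T b ->
          forall v w, m T (b v w) = b (m V v) (m W w))
    & (forall V0 : gmod, C V0 -> trivial1 V0 -> forall v, m V0 v = v)].

Definition Mset (C : gmod -> Prop) du := {m : gfamily | in_M C du m}.

Definition fcoef C du (V : gmod) (phi : V -> F) (v : V) : Mset C du -> F :=
  fun m => phi (proj1_sig m V v).

Definition in_LieM (C : gmod -> Prop) du (x : gfamily) : Prop :=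
  [/\ in_Nat C du x,
      (forall (V W T : gmod) b, C V -> C W -> C T -> @is_tensor V W T b ->
          forall v w, x T (b v w) = b (x V v) w + b v (x W w)),
      (forall V0 : gmod, C V0 -> trivial1 V0 -> forall v, x V0 v = 0)
    & exists delta : (Mset C du -> F) -> F,
        forall (V : gmod) phi v, C V -> du V phi -> delta (fcoef phi v) = phi (x V v)].

End LieDefs.

(* Main.v *)
(** Two pointwise facts carry the proof. First, if [s] and [n] commute, [q(s) v = 0]
    with [q] separable and [n^k v = 0], then [s v = P(s + n) v] for a polynomial [P]
    depending only on [q] and [k] (Newton iteration). Since [P] can be chosen
    simultaneously for [v] and for its image under a linear map intertwining two
    operators, Jordan-Chevalley parts are natural and unique. On a tensor product,
    [s_V (x) 1 + 1 (x) s_W] and [n_V (x) 1 + 1 (x) n_W] form a decomposition of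
    [x_(V (x) W)], because a sum of commuting diagonalizable matrices over [L] is
    diagonalizable; uniqueness then makes [s] and [n] derivations. Second, if [f_{phi v}]
    vanishes on [M] then so does [f_{phi (x v)}], since [delta_x] can be applied to
    [f_{(phi o m) v} = 0] for every [m] in [M]; hence [phi (x^k v) = 0] for all [k],
    so [phi (s v) = 0]. Direct sums turn this into the well-definedness of [delta_s]. *)
Require Import Defs.
From HB Require Import structures.
From mathcomp Require Import all_boot all_order all_algebra.
From mathcomp Require Import separable.
From Stdlib Require Import Classical ClassicalEpsilon FunctionalExtensionality.
Set Implicit Arguments. Unset Strict Implicit. Unset Printing Implicit Defensive.
Import GRing.Theory.
Local Open Scope ring_scope.

(** * Elementary consequences of linearity *)

Section LinTheory.
Variables (F : fieldType) (V W : lmodType F) (f : V -> W).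
Hypothesis lf : lin f.

Lemma lin0 : f 0 = 0.
Proof. by have := lf (-1) 0 0; rewrite scaler0 addr0 scaleN1r addNr. Qed.

Lemma linD u v : f (u + v) = f u + f v.
Proof. by have := lf 1 u v; rewrite !scale1r. Qed.

Lemma linZ a v : f (a *: v) = a *: f v.
Proof. by have := lf a v 0; rewrite !addr0 lin0 addr0. Qed.

Lemma linB u v : f (u - v) = f u - f v.
Proof. by rewrite linD -scaleN1r linZ scaleN1r. Qed.

Lemma lin_sum n (G : 'I_n -> V) : f (\sum_(i < n) G i) = \sum_(i < n) f (G i).
Proof. exact: (big_morph f linD lin0). Qed.

End LinTheory.

(** * Polynomials acting through an operator *)

Section PolyAct.
Variable F : fieldType.
Implicit Types (V W : lmodType F) (p q : {poly F}).

Definition polyact V (y : V -> V) p (v : V) : V :=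
  \sum_(i < size p) p`_i *: iter i y v.

Lemma polyact_widen V (y : V -> V) p v m : (size p <= m)%N ->
  polyact y p v = \sum_(i < m) p`_i *: iter i y v.
Proof.
move=> hm; rewrite /polyact (big_ord_widen m (fun i => p`_i *: iter i y v)) //.
rewrite big_mkcond; apply: eq_bigr => i _; case: ifP => // /negbT.
by rewrite -leqNgt => hi; rewrite nth_default // scale0r.
Qed.

Lemma polyact0 V (y : V -> V) v : polyact y 0 v = 0.
Proof. by rewrite (@polyact_widen _ _ _ _ 0) ?size_poly0 // big_ord0. Qed.

Lemma polyactMXaddC V (y : V -> V) p c v :
  polyact y (p * 'X + c%:P) v = polyact y p (y v) + c *: v.
Proof.
have hs : (size (p * 'X + c%:P)%R <= (size p).+1)%N.
  by rewrite size_MXaddC; case: ifP.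
rewrite (polyact_widen _ _ hs) big_ord_recl addrC /= coefD coefMX coefC add0r.
congr (_ + _); apply: eq_bigr => i _.
by rewrite coefD coefMX coefC /= addr0 -iterS iterSr.
Qed.

Lemma polyactD V (y : V -> V) p q v :
  polyact y (p + q) v = polyact y p v + polyact y q v.
Proof.
pose m := maxn (size p) (size q).
rewrite !(@polyact_widen _ _ _ _ m) ?leq_maxl ?leq_maxr ?size_polyD //.
by rewrite -big_split /=; apply: eq_bigr => i _; rewrite coefD scalerDl.
Qed.

Lemma polyactZ V (y : V -> V) c p v : polyact y (c *: p) v = c *: polyact y p v.
Proof.
rewrite !(@polyact_widen _ _ _ _ (size p)) ?size_scale_leq //.
by rewrite scaler_sumr; apply: eq_bigr => i _; rewrite coefZ scalerA.
Qed.

Lemma polyactB V (y : V -> V) p q v :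
  polyact y (p - q) v = polyact y p v - polyact y q v.
Proof. by rewrite polyactD -(scaleN1r q) polyactZ scaleN1r. Qed.

Lemma polyactC V (y : V -> V) c v : polyact y c%:P v = c *: v.
Proof. by rewrite -[c%:P]add0r -(mul0r 'X) polyactMXaddC polyact0 add0r. Qed.

Lemma polyactX V (y : V -> V) v : polyact y 'X v = y v.
Proof.
by rewrite -['X]mul1r -[1 * _]addr0 polyactMXaddC scale0r addr0 polyactC scale1r.
Qed.

(** Main transport tool: with [f] an operator commuting with [y] it gives commutation with
    [polyact y p]; with [f] a parametrization by matrices it carries matrix identities into a
    module. *)
Lemma polyact_intertwine V W (f : V -> W) y y' p v : lin f ->
  (forall u, f (y u) = y' (f u)) -> f (polyact y p v) = polyact y' p (f v).
Proof.
move=> lf fy; rewrite (lin_sum lf); apply: eq_bigr => i _; rewrite (linZ lf).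
by congr (_ *: _); elim: (nat_of_ord i) => //= k <-.
Qed.

Lemma lin_polyact V (y : V -> V) p : lin y -> lin (polyact y p).
Proof.
move=> ly; elim/poly_ind: p => [|p c IH] a u v.
  by rewrite !polyact0 scaler0 addr0.
by rewrite !polyactMXaddC ly IH !scalerDr addrACA !scalerA mulrC.
Qed.

Lemma polyactM V (y : V -> V) p q v : lin y ->
  polyact y (p * q) v = polyact y p (polyact y q v).
Proof.
move=> ly; elim/poly_ind: p v => [|p c IH] v; first by rewrite mul0r !polyact0.
rewrite polyactMXaddC mulrDl -mulrA ['X * q]mulrC mulrA mul_polyC polyactD polyactZ.
rewrite -[p * q * 'X]addr0 polyactMXaddC scale0r addr0 IH.
by rewrite (@polyact_intertwine _ _ y y y).
Qed.

Lemma polyact_comp V (y : V -> V) p q v : lin y ->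
  polyact y (p \Po q) v = polyact (polyact y q) p v.
Proof.
move=> ly; elim/poly_ind: p v => [|p c IH] v; first by rewrite comp_poly0 !polyact0.
by rewrite comp_poly_MXaddC polyactD polyactC polyactM // IH polyactMXaddC.
Qed.

Lemma polyact_dvd V (y : V -> V) p q v : lin y -> p %| q ->
  polyact y p v = 0 -> polyact y q v = 0.
Proof.
by move=> ly /dvdpP[r ->] pv; rewrite polyactM // pv (lin0 (lin_polyact r ly)).
Qed.

(** First-order Taylor expansion at [s]: the higher terms vanish because [d] applied twice kills
    [u]. This is asked at the single vector [u], which is what the Newton step provides. *)
Lemma polyact_taylor1 V (s d : V -> V) p u : lin s -> lin d ->
  (forall v, s (d v) = d (s v)) -> d (d u) = 0 ->
  polyact (fun v => s v + d v) p u = polyact s p u + polyact s p^`() (d u).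
Proof.
move=> ls ld sd; elim/poly_ind: p u => [|p c IH] u ddu.
  by rewrite deriv0 !polyact0 addr0.
have lsd : lin (fun v => s v + d v).
  by move=> a v w; rewrite ls ld scalerDr addrACA.
rewrite derivMXaddC !polyactMXaddC polyactD -[_ * 'X]addr0 polyactMXaddC.
rewrite scale0r addr0 (linD (lin_polyact p lsd)).
rewrite IH; last by rewrite -!sd ddu (lin0 ls).
rewrite (IH (d u)); last by rewrite ddu (lin0 ld).
rewrite ddu (lin0 (lin_polyact _ ls)) addr0 -sd.
rewrite -!addrA; congr (_ + _).
by rewrite addrC (addrC (polyact s p (d u))) -addrA.
Qed.

End PolyAct.

(** * The semisimple part as a polynomial in the sum *)

Section JordanPolynomial.
Variable F : fieldType.
Implicit Types V W : lmodType F.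

(** Pointwise, basis-free form of semisimplicity: on the cyclic subspace generated by [v], being
    killed by a separable polynomial amounts to diagonalizability over an algebraic closure. *)
Definition separably_killed V (s : V -> V) (v : V) :=
  exists q, separable_poly q /\ polyact s q v = 0.

(* Newton iteration: if [P] works for exponent [k] then [d := P(x) - s] satisfies
   [d (d u) = 0], and [P - (a q)(P)] works for [k.+1], where [a q' + b q = 1]. *)
Lemma jordan_polynomial (q : {poly F}) k : separable_poly q ->
  exists P : {poly F}, forall V (x s n : V -> V), lin s -> lin n ->
    (forall v, s (n v) = n (s v)) -> (forall v, x v = s v + n v) ->
    forall u, polyact s q u = 0 -> iter k.+1 n u = 0 -> s u = polyact x P u.
Proof.
rewrite separable_poly.unlock => /Bezout_eq1_coprimepP[[b a] /= bez].
elim: k => [|k [P IH]].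
  by exists 'X => V x s n _ _ _ xE u _ /= nu; rewrite polyactX xE nu addr0.
exists (('X - a * q) \Po P) => V x s n ls ln sn xE u qu nu.
have lx : lin x by move=> c v w; rewrite !xE ls ln scalerDr addrACA.
have sx v : s (x v) = x (s v) by rewrite !xE (linD ls) sn.
have nx v : n (x v) = x (n v) by rewrite !xE (linD ln) sn.
have lP := lin_polyact P lx.
have sP v : s (polyact x P v) = polyact x P (s v) by exact: polyact_intertwine.
have nP v : n (polyact x P v) = polyact x P (n v) by exact: polyact_intertwine.
pose d v := polyact x P v - s v.
have ld : lin d.
  move=> c v w; rewrite /d lP ls scalerBr opprD -!addrA; congr (_ + _).
  by rewrite addrCA.
have sd v : s (d v) = d (s v) by rewrite /d (linB ls) sP.
have nd v : n (d v) = d (n v) by rewrite /d (linB ln) nP sn.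
have itn m v : iter m n (d v) = d (iter m n v) by elim: m => //= m ->.
have d0 v : polyact s q v = 0 -> iter k.+1 n v = 0 -> d v = 0.
  by move=> qv nv; rewrite /d (IH V x s n) ?subrr.
have ls0 p := lin0 (lin_polyact p ls).
have dq p v : d (polyact s p v) = polyact s p (d v) by exact: polyact_intertwine.
(* Applying [n] to [d u] [k.+1] times gives [d] of [iter k.+1 n u]. That vector is killed by [q(s)]
   and again by [iter k.+1 n], so [d0] applies first to it and then to [d u]. *)
have ddu : d (d u) = 0.
  apply: (d0); first by rewrite -dq qu (lin0 ld).
  rewrite itn; apply: d0.
    have nq v p : n (polyact s p v) = polyact s p (n v).
      exact: polyact_intertwine.
    have -> : polyact s q (iter k.+1 n u) = iter k.+1 n (polyact s q u).
      by elim: k.+1 => //= m IHm; rewrite -nq IHm.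
    by rewrite qu; elim: k.+1 => //= m ->; rewrite (lin0 ln).
  by rewrite -iterD addSnnS iterD [iter k.+2 n u]nu; elim: (k) => //= m ->;
    rewrite (lin0 ln).
have Pd : polyact x P = fun v => s v + d v.
  by apply: functional_extensionality => v; rewrite /d addrC subrK.
have lsd : lin (fun v => s v + d v) by rewrite -Pd.
(* Taylor expansion turns [q(s + d) u] into [q'(s) (d u)]; applying [a] gives
   [(1 - b q)(s) (d u) = d u], exactly the error of [P(x) u]. *)
rewrite polyact_comp // Pd polyactB polyactX polyactM //.
rewrite [polyact _ q u]polyact_taylor1 // qu add0r polyact_taylor1 //.
  rewrite dq ddu !ls0 addr0 -polyactM //.
  have -> : a * q^`() = 1 - b * q by rewrite -bez addrC addKr.
  rewrite polyactB polyactM // -(dq q) qu (lin0 ld) ls0 subr0.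
  by rewrite -[1]/(1%:P) polyactC scale1r addrK.
by rewrite dq ddu ls0 (lin0 ld).
Qed.

(** Lets one polynomial serve both a vector and its image. A common factor [e] of [p] and [h] also
    divides [gcdp p q], so [e * e] divides [q], and separability makes [e] constant. *)
Lemma separable_lcm (p q : {poly F}) : separable_poly p -> separable_poly q ->
  exists r, [/\ separable_poly r, p %| r & q %| r].
Proof.
move=> sp sq; pose h := q %/ gcdp p q.
have hq : h * gcdp p q = q by rewrite divpK ?dvdp_gcdr.
exists (p * h); split; [|exact: dvdp_mulr|]; last first.
  by rewrite -hq mulrC dvdp_mul ?dvdp_gcdl.
rewrite separable_mul sp (dvdp_separable _ sq) /=; last by rewrite -hq dvdp_mulr.
rewrite -[coprimep p h]/(size (gcdp p h) == 1%N).
set e := gcdp p h.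
have eg : e %| gcdp p q.
  rewrite dvdp_gcd dvdp_gcdl (dvdp_trans (dvdp_gcdr _ _)) //.
  by rewrite -hq dvdp_mulr.
have : coprimep e e.
  by apply: (separable_coprime sq); rewrite -hq dvdp_mul ?dvdp_gcdr.
by rewrite coprimepp.
Qed.

(** One [P] computes [s] at [v] and [s'] at [f v], and [f] carries [P(x)] to [P(x')]. The killing
    and nilpotency conditions concern only [v] and [f v], so on tensor products they can be checked
    on pure tensors. *)
Lemma semisimple_intertwine V W (f : V -> W) (x s n : V -> V) (x' s' n' : W -> W) v :
  lin f -> lin s -> lin n -> lin s' -> lin n' ->
  (forall v, s (n v) = n (s v)) -> (forall v, x v = s v + n v) ->
  (forall v, s' (n' v) = n' (s' v)) -> (forall v, x' v = s' v + n' v) ->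
  (forall v, f (x v) = x' (f v)) ->
  separably_killed s v -> (exists k, iter k n v = 0) ->
  separably_killed s' (f v) -> (exists k, iter k n' (f v) = 0) ->
  f (s v) = s' (f v).
Proof.
move=> lf ls ln ls' ln' sn xE sn' xE' fx [q [sq qv]] [k nv] [q' [sq' qv']] [k' nv'].
have [r [sr qr qr']] := separable_lcm sq sq'.
have [P PE] := jordan_polynomial (k + k') sr.
have it0 (U : lmodType F) (m : U -> U) w i j :
    lin m -> iter i m w = 0 -> iter (j + i) m w = 0.
  by move=> lm; rewrite iterD => ->; elim: j => //= j ->; rewrite (lin0 lm).
rewrite (PE V x s n) //; last 2 first.
- exact: polyact_dvd qr qv.
- by rewrite addnC -addSn; apply: it0.
rewrite (PE W x' s' n') //; last 2 first.
- exact: polyact_dvd qr' qv'.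
- by rewrite -addSn; apply: it0.
exact: polyact_intertwine.
Qed.

End JordanPolynomial.

(** * Separable polynomials, diagonalizability and sums on tensors *)

Section Separability.
Variables (F : fieldType) (L : closedFieldType) (iota : {rmorphism F -> L}).
Implicit Types V W T : lmodType F.

(** The minimal polynomial divides [q] and splits over the closed field [L] into linear factors,
    distinct by separability. *)
Lemma diagonalizable_separable N (A : 'M[F]_N.+1) (q : {poly F}) :
  separable_poly q -> horner_mx A q = 0 -> diagonalizable (map_mx iota A).
Proof.
move=> sq /mxminpoly_min/dvdp_separable-/(_ sq) sA; apply/diagonalizableP.
rewrite mxminpoly_map.
have [rs E] := closed_field_poly_normal (map_poly iota (mxminpoly A)).
move: E; rewrite lead_coef_map (eqP (mxminpoly_monic A)) rmorph1 scale1r => E.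
by exists rs; [rewrite -separable_prod_XsubC -E separable_map | rewrite -E].
Qed.

Lemma separable_mxminpoly N (A : 'M[F]_N.+1) :
  diagonalizable (map_mx iota A) -> separable_poly (mxminpoly A).
Proof.
case/diagonalizableP=> rs urs; rewrite mxminpoly_map => /dvdp_separable.
by rewrite separable_map separable_prod_XsubC; apply.
Qed.

Lemma diagonalizable_add (K : fieldType) N (A B : 'M[K]_N) : comm_mx A B ->
  diagonalizable A -> diagonalizable B -> diagonalizable (A + B).
Proof.
move=> cAB dA dB.
have [P uP] : codiagonalizable [:: A; B].
  apply/codiagonalizableP; split=> [X Y|X]; rewrite !inE.
    by do 2![case/orP=> /eqP->] => //; apply: comm_mx_sym.
  by case/orP=> /eqP->.
rewrite /= andbT => /andP[/(diagonalizable_forP _ uP) PA /(diagonalizable_forP _ uP) PB].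
exists P => //; apply/(diagonalizable_forP _ uP) => i j ij.
by rewrite mulmxDr mulmxDl mxE PA // PB // addr0.
Qed.

Lemma polyact_mulmxr m N (A : 'M[F]_N.+1) (p : {poly F}) (M : 'M_(m, N.+1)) :
  polyact (mulmxr A) p M = M *m horner_mx A p.
Proof.
elim/poly_ind: p M => [|p c IH] M; first by rewrite polyact0 rmorph0 mulmx0.
rewrite polyactMXaddC IH rmorphD rmorphM /= horner_mx_X horner_mx_C mulmxDr.
by rewrite mul_mx_scalar -mulmxA (comm_mx_horner p (comm_mx_refl A)).
Qed.


Lemma polyact_mulmx m N (A : 'M[F]_N.+1) (p : {poly F}) (M : 'M_(N.+1, m)) :
  polyact (mulmx A) p M = horner_mx A p *m M.
Proof.
elim/poly_ind: p M => [|p c IH] M; first by rewrite polyact0 rmorph0 mul0mx.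
rewrite polyactMXaddC IH rmorphD rmorphM /= horner_mx_X horner_mx_C mulmxDl.
by rewrite mul_scalar_mx mulmxA.
Qed.

Lemma horner_mx_tr N (A : 'M[F]_N.+1) (p : {poly F}) :
  horner_mx A^T p = (horner_mx A p)^T.
Proof.
elim/poly_ind: p => [|p c IH]; first by rewrite !rmorph0 trmx0.
rewrite !rmorphD !rmorphM /= !horner_mx_X !horner_mx_C IH linearD /= tr_scalar_mx.
by rewrite -[_ * A^T]trmx_mul (comm_mx_horner p (comm_mx_refl A)).
Qed.

Lemma horner_mx_eq0 N (A : 'M[F]_N.+1) (p : {poly F}) :
  (forall u : 'rV_N.+1, polyact (mulmxr A) p u = 0) -> horner_mx A p = 0.
Proof.
by move=> h; apply/row_matrixP => i; rewrite rowE -polyact_mulmxr h row0.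
Qed.

(** The iterates of [v] transform by the companion matrix of [p]: each row shifts by one except the
    last, which encodes [p(y) v = 0]. The iterates may be dependent. *)
Lemma cyclic_companion V (y : V -> V) (p : {poly F}) v :
  p \is monic -> (1 < size p)%N -> polyact y p v = 0 ->
  exists N (A : 'M[F]_N.+1), [/\ size p = N.+2, char_poly A = p
    & forall i : 'I_N.+1, y (iter i y v) = \sum_(j < N.+1) A i j *: iter j y v].
Proof.
move=> mp sp pv; have := companionmxK mp.
have cE i j : companionmx p i j = if (i == (size p).-1.-1 :> nat) then - p`_j
    else (i.+1 == j :> nat)%:R by rewrite mxE.
move: (companionmx p) cE.
have [N Np] : exists N, size p = N.+2 by case: (size p) sp => [|[|N]] //; exists N.
rewrite Np /= => A cE cA; exists N, A; split=> // i; rewrite -iterS.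
have [iN|iN] := eqVneq (i : nat) N; last first.
  have iN1 : (i.+1 < N.+1)%N by rewrite ltn_neqAle eqSS iN ltn_ord.
  rewrite (bigD1 (Ordinal iN1)) //= cE (negPf iN) eqxx scale1r big1 ?addr0 // => j ji.
  by rewrite cE (negPf iN) eq_sym (negPf (ji : (j != i.+1 :> nat))) scale0r.
move: pv; rewrite /polyact Np big_ord_recr /= -[p`_N.+1]/(p`_(N.+2.-1)) -Np.
rewrite -lead_coefE (eqP mp) scale1r => /eqP; rewrite addrC addr_eq0 => /eqP pv.
rewrite iN pv -sumrN; apply: eq_bigr => j _.
by rewrite cE iN eqxx scaleNr.
Qed.

(** The family [e] may be dependent, so instead of taking coordinates [th] maps row vectors into
    [V], intertwining right multiplication by [A] with [y]. *)
Lemma polyact_frame V (y : V -> V) n (e : 'I_n.+1 -> V) (A : 'M[F]_n.+1) (p : {poly F}) :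
  lin y -> (forall i, y (e i) = \sum_(j < n.+1) A i j *: e j) ->
  horner_mx A p = 0 -> forall i, polyact y p (e i) = 0.
Proof.
move=> ly ye Ap i; pose th (u : 'rV[F]_n.+1) := \sum_(j < n.+1) u 0 j *: e j.
have lth : lin th.
  move=> a u w; rewrite /th scaler_sumr -big_split; apply: eq_bigr => j _.
  by rewrite !mxE scalerDl scalerA.
have thy u : th (mulmxr A u) = y (th u).
  rewrite /th (lin_sum ly).
  under [RHS]eq_bigr => j _ do rewrite (linZ ly) ye scaler_sumr.
  rewrite exchange_big /=; apply: eq_bigr => k _; rewrite mxE scaler_suml.
  by apply: eq_bigr => j _; rewrite scalerA.
have -> : e i = th (delta_mx 0 i).
  rewrite /th (bigD1 i) //= mxE !eqxx scale1r big1 ?addr0 // => j ji.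
  by rewrite mxE (negPf ji) andbF scale0r.
by rewrite -(polyact_intertwine p _ lth thy) polyact_mulmxr Ap mulmx0 (lin0 lth).
Qed.

Lemma locally_finite_killed V (y : V -> V) v : lin y -> locally_finite y ->
  exists p, p \is monic /\ polyact y p v = 0.
Proof.
move=> ly /(_ v)[[|n] [vs [inv [c ->]]]].
  by exists 1; rewrite monic1 big_ord0 (lin0 (lin_polyact 1 ly)).
have [A0 AE] : exists A : 'I_n.+1 -> 'I_n.+1 -> F,
    forall i, y (vs i) = \sum_(j < n.+1) A i j *: vs j.
  apply: (fin_all_exists (P := fun i (c : 'I_n.+1 -> F) =>
    y (vs i) = \sum_(j < n.+1) c j *: vs j)) inv.
pose A := \matrix_(i, j) A0 i j.
exists (char_poly A); split; first exact: char_poly_monic.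
rewrite (lin_sum (lin_polyact _ ly)) big1 // => i _.
rewrite (linZ (lin_polyact _ ly)) (polyact_frame (A := A) ly) ?scaler0 //.
  by move=> k; rewrite AE; apply: eq_bigr => j _; rewrite mxE.
exact: Cayley_Hamilton.
Qed.

(** Descent on the size, normalizing each smaller killing polynomial to be monic. Minimality later
    makes the iterates of [v] below the degree of [p] independent. *)
Lemma minimal_killing V (y : V -> V) v : lin y -> locally_finite y ->
  exists p, [/\ p \is monic, polyact y p v = 0 & forall q, q != 0 ->
    polyact y q v = 0 -> (size p <= size q)%N].
Proof.
move=> ly /(locally_finite_killed v ly)[p [mp pv]].
have [m] := ubnP (size p); elim: m => // m IH in p mp pv *; rewrite ltnS => pm.
have [[q [q0 qv qp]]|h] :=
  classic (exists q, [/\ q != 0, polyact y q v = 0 & (size q < size p)%N]).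
  apply: (IH ((lead_coef q)^-1 *: q)).
  - by rewrite monicE lead_coefZ mulVf ?lead_coef_eq0.
  - by rewrite polyactZ qv scaler0.
  - by rewrite size_scale ?invr_eq0 ?lead_coef_eq0 // (leq_trans qp).
exists p; split=> // q q0 qv; rewrite leqNgt; apply/negP => qp.
by apply: h; exists q.
Qed.

(** The iterates of [v] below the degree of a minimal killing polynomial form a basis of an
    invariant subspace. [semisimple_op] applies to their companion matrix, whose minimal polynomial
    is then separable and kills [v]. *)
Lemma semisimple_separably_killed V (y : V -> V) v :
  lin y -> semisimple_op iota y -> separably_killed y v.
Proof.
move=> ly [lfy diag]; have [p [mp pv pmin]] := minimal_killing v ly lfy.
have p0 := monic_neq0 mp.
have [sp1|sp1] := leqP (size p) 1.
  exists p; split=> //; rewrite separable_poly.unlock.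
  have p1 : p = 1.
    by move: mp; rewrite (size1_polyC sp1) monicE lead_coefC => /eqP->.
  by rewrite p1 coprime1p.
have [N [A [sp cA yA]]] := cyclic_companion mp sp1 pv.
exists (mxminpoly A); split.
  apply/separable_mxminpoly/(diag _ (fun i : 'I_N.+1 => iter i y v) _ _ yA).
  (* A linear relation among the iterates is a polynomial of smaller size killing [v], hence zero by
     minimality. *)
  move=> c c0 i; pose q := rVpoly (\row_j c j).
  have qj (j : 'I_N.+1) : q`_j = c j by rewrite coef_rVpoly_ord mxE.
  have [q0|q0] := eqVneq q 0; first by rewrite -qj q0 coef0.
  have sq : (size q <= N.+1)%N by exact: size_poly.
  suff /(pmin _ q0) : polyact y q v = 0 by rewrite sp leqNgt ltnS sq.
  rewrite (polyact_widen _ _ sq) -[RHS]c0.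
  by apply: eq_bigr => j _; rewrite qj.
exact: (polyact_frame ly yA (mx_root_minpoly A) ord0).
Qed.

Lemma killed_frame V (y : V -> V) v : lin y -> separably_killed y v ->
  exists N (e : 'I_N.+1 -> V) (A : 'M[F]_N.+1) q, [/\ e ord0 = v,
    forall i, y (e i) = \sum_(j < N.+1) A i j *: e j,
    separable_poly q & horner_mx A q = 0].
Proof.
move=> ly [q [sq qv]]; have q0 := separable_poly_neq0 sq.
have l0 : lead_coef q != 0 by rewrite lead_coef_eq0.
have [sq1|sq1] := leqP (size q) 1.
  have v0 : v = 0.
    move: qv l0; rewrite (size1_polyC sq1) polyactC lead_coefC => /eqP.
    by rewrite scaler_eq0 => /orP[->|/eqP].
  (* As [v = 0], a frame made of one zero vector with zero matrix, killed by the separable ['X],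
     keeps the size positive. *)
  exists 0, (fun=> 0), 0, 'X; split=> //.
  - by move=> i; rewrite (lin0 ly) big1 // => j _; rewrite scaler0.
  - by rewrite separable_poly.unlock derivX coprimep1.
  - by rewrite horner_mx_X.
pose p := (lead_coef q)^-1 *: q.
have pq : p %= q by rewrite eqp_scale ?invr_eq0.
have mp : p \is monic by rewrite monicE lead_coefZ mulVf.
have [||N [A [_ cA yA]]] := cyclic_companion mp (y := y) (v := v).
- by rewrite (eqp_size pq).
- by rewrite polyactZ qv scaler0.
exists N, (fun i => iter i y v), A, p; split=> //.
  by rewrite (eqp_separable pq).
by rewrite -cA; exact: Cayley_Hamilton.
Qed.

(** Matrices [M] parametrize combinations of the [b (e i) (f j)], and [S] becomes [h]. Left and
    right multiplication commute and are each killed by a separable polynomial, so their sum is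
    diagonalizable over [L]. *)
Lemma tensor_separably_killed V W T (b : V -> W -> T) y1 y2 (S : T -> T) v w :
  bilin b -> lin y1 -> lin y2 -> lin S ->
  (forall v w, S (b v w) = b (y1 v) w + b v (y2 w)) ->
  separably_killed y1 v -> separably_killed y2 w -> separably_killed S (b v w).
Proof.
move=> [b1 b2] l1 l2 lS SE /(killed_frame l1)[m [e [A [p [ev yA sp Ap]]]]].
move=> /(killed_frame l2)[n [f [B [q [fw yB sq Bq]]]]].
pose th (M : 'M[F]_(m.+1, n.+1)) := \sum_i \sum_j M i j *: b (e i) (f j).
have lth : lin th.
  move=> a M M'; rewrite /th scaler_sumr -big_split; apply: eq_bigr => i _ /=.
  rewrite scaler_sumr -big_split; apply: eq_bigr => j _.
  by rewrite !mxE scalerDl scalerA.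
pose h M := A^T *m M + M *m B.
have thS M : th (h M) = S (th M).
  rewrite /h (linD lth) /th (lin_sum lS).
  under [RHS]eq_bigr => i _.
    rewrite (lin_sum lS).
    under eq_bigr => j _.
      rewrite (linZ lS) SE yA yB (lin_sum (b1 _)) (lin_sum (b2 _)) scalerDr.
      rewrite !scaler_sumr.
      over.
    rewrite big_split /=.
    over.
  rewrite big_split /=; congr (_ + _).
    under [RHS]eq_bigr => k _ do rewrite exchange_big /=.
    rewrite [RHS]exchange_big /=; apply: eq_bigr => i _.
    rewrite [RHS]exchange_big /=; apply: eq_bigr => j _.
    rewrite mxE scaler_suml; apply: eq_bigr => k _.
    by rewrite (linZ (b1 _)) scalerA mxE mulrC.
  apply: eq_bigr => i _; rewrite [RHS]exchange_big /=; apply: eq_bigr => k _.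
  rewrite mxE scaler_suml; apply: eq_bigr => j _.
  by rewrite (linZ (b2 _)) scalerA.
(* The size is spelled as a successor for [horner_mx]; it is convertible to the product. *)
pose HA : 'M[F]_((m.+1 * n.+1).-1.+1) := lin_mx (mulmx A^T : 'M_(m.+1, n.+1) -> _).
pose HB : 'M[F]_((m.+1 * n.+1).-1.+1) :=
  lin_mx (mulmxr B : 'M_(m.+1, n.+1) -> _).
pose vec (M : 'M[F]_(m.+1, n.+1)) : 'rV[F]_((m.+1 * n.+1).-1.+1) := mxvec M.
have lvec : lin vec by move=> a M M'; rewrite /vec linearP.
have vec_surj u : exists M, u = vec M.
  exists (vec_mx (u : 'rV_(m.+1 * n.+1))).
  by rewrite /vec vec_mxK.
have HAE M : vec M *m HA = vec (A^T *m M) by exact: (mul_vec_lin (mulmx A^T) M).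
have HBE M : vec M *m HB = vec (M *m B) by exact: (mul_vec_lin (mulmxr B) M).
have HAp : horner_mx HA p = 0.
  apply: horner_mx_eq0 => u; have [M ->] := vec_surj u.
  rewrite -(polyact_intertwine (f := vec) (y := mulmx A^T)) //; last first.
    by move=> M'; rewrite /= HAE.
  by rewrite polyact_mulmx horner_mx_tr Ap trmx0 mul0mx (lin0 lvec).
have HBq : horner_mx HB q = 0.
  apply: horner_mx_eq0 => u; have [M ->] := vec_surj u.
  rewrite -(polyact_intertwine (f := vec) (y := mulmxr B)) //; last first.
    by move=> M'; rewrite /= HBE.
  by rewrite polyact_mulmxr Bq mulmx0 (lin0 lvec).
have cH : comm_mx HA HB.
  apply/row_matrixP => i; rewrite !rowE.
  by have [M ->] := vec_surj (delta_mx 0 i); rewrite !mulmxA !HAE !HBE HAE mulmxA.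
have sr : separable_poly (mxminpoly (HA + HB)).
  apply: separable_mxminpoly; rewrite map_mxD; apply: diagonalizable_add => /=.
  - by rewrite /comm_mx -!map_mxM cH.
  - exact: diagonalizable_separable sp HAp.
  - exact: diagonalizable_separable sq HBq.
exists (mxminpoly (HA + HB)); split=> //.
have -> : b v w = th (delta_mx ord0 ord0).
  rewrite /th (bigD1 ord0) //= (bigD1 ord0) //= !mxE !eqxx scale1r ev fw.
  rewrite big1 ?addr0 => [|j /negPf j0]; last by rewrite mxE j0 andbF scale0r.
  rewrite big1 ?addr0 // => i /negPf i0.
  by rewrite big1 // => j _; rewrite mxE i0 scale0r.
rewrite -(polyact_intertwine _ _ lth thS).
set M := polyact h _ _; suff -> : M = 0 by exact: lin0.
apply: (can_inj mxvecK); rewrite linear0.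
rewrite -[LHS]/(vec M) (polyact_intertwine (y' := mulmxr (HA + HB)) _ _ lvec).
  by rewrite polyact_mulmxr mx_root_minpoly mulmx0.
by move=> M'; rewrite /= mulmxDr HAE HBE (linD lvec).
Qed.

End Separability.

(** * Comparison of Jordan-Chevalley decompositions *)

Section JordanChevalley.
Variables (F : fieldType) (L : closedFieldType) (iota : {rmorphism F -> L}).

(** Gives naturality when [f] is a morphism and uniqueness when [f] is the identity. *)
Lemma JC_intertwine (V W : lmodType F) (f : V -> W) (x s n : V -> V)
    (x' s' n' : W -> W) :
  lin f -> lin s -> lin n -> lin s' -> lin n' ->
  JC_decomp iota x s n -> JC_decomp iota x' s' n' ->
  (forall v, f (x v) = x' (f v)) -> forall v, f (s v) = s' (f v).
Proof.
move=> lf ls ln ls' ln' [ss nn sn xE] [ss' nn' sn' xE'] fx v.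
apply: (semisimple_intertwine lf ls ln ls' ln' sn xE sn' xE' fx).
- exact: semisimple_separably_killed ss.
- exact: nn.
- exact: semisimple_separably_killed ss'.
- exact: nn'.
Qed.

(** [P] is chosen separately for each [v]; this is enough to follow one orbit of [x] at a time. *)
Lemma JC_polynomial (V : lmodType F) (x s n : V -> V) : lin s -> lin n ->
  JC_decomp iota x s n -> forall v, exists P, s v = polyact x P v.
Proof.
move=> ls ln [ss nn sn xE] v.
have [q [sq qv]] := semisimple_separably_killed v ls ss.
have [k nv] := nn v; have [P PE] := jordan_polynomial k sq.
by exists P; apply: (PE V x s n) => //=; rewrite nv (lin0 ln).
Qed.

(** Comparison with the decomposition [0 = 0 + 0]; meant for trivial one-dimensional modules. *)
Lemma JC_of_zero (V : lmodType F) (s n : V -> V) : lin s -> lin n ->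
  JC_decomp iota (fun=> 0) s n -> forall v, s v = 0.
Proof.
move=> ls ln [ss nn sn xE] v.
have l0 : lin (fun=> 0 : V) by move=> a u w; rewrite scaler0 addr0.
apply: (@semisimple_intertwine F V V id (fun=> 0) s n
  (fun=> 0) (fun=> 0) (fun=> 0)) => //.
- by move=> u; rewrite addr0.
- exact: semisimple_separably_killed ss.
- exists 'X; split; last by rewrite polyactX.
  by rewrite separable_poly.unlock derivX coprimep1.
- by exists 1%N.
Qed.

End JordanChevalley.

(** * Derivations on a tensor product *)

Section Tensor.
Variables (F : fieldType) (g : lmodType F) (br : g -> g -> g).
Variables (V W T : gmod br) (b : V -> W -> T).
Hypothesis bT : is_tensor b.

Lemma tensor_ext (Z : lmodType F) (f f' : T -> Z) : lin f -> lin f' ->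
  (forall v w, f (b v w) = f' (b v w)) -> forall t, f t = f' t.
Proof.
case: bT => [[b1 b2] _ univ] lf lf' ff' t.
have [|h [lh _ hu]] := univ Z (fun v w => f (b v w)).
  by split=> [w a u v|v a u w]; [rewrite b1 lf | rewrite b2 lf].
by rewrite (hu f) ?(hu f').
Qed.

Lemma tensor_derivation (y1 : V -> V) (y2 : W -> W) : lin y1 -> lin y2 ->
  exists S : T -> T, lin S /\ forall v w, S (b v w) = b (y1 v) w + b v (y2 w).
Proof.
case: bT => [[b1 b2] _ univ] l1 l2.
have [|h [lh hb _]] := univ T (fun v w => b (y1 v) w + b v (y2 w)).
  split=> [w a u v|v a u w].
    by rewrite l1 !b1 scalerDr addrACA.
  by rewrite l2 !b2 scalerDr addrACA.
by exists h.
Qed.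

(** [N] splits a pure tensor into two, each with one exponent lowered, so [i + j] applications
    suffice; once an exponent is zero the tensor itself is zero. *)
Lemma tensor_derivation_nilpotent (n1 : V -> V) (n2 : W -> W) (N : T -> T) v w :
  lin N -> (forall v w, N (b v w) = b (n1 v) w + b v (n2 w)) ->
  (exists k, iter k n1 v = 0) -> (exists k, iter k n2 w = 0) ->
  exists k, iter k N (b v w) = 0.
Proof.
case: bT => [[b1 b2] _ _] lN NE [i iv] [j jw].
have it0 m : iter m N 0 = 0 by elim: m => //= m ->; rewrite (lin0 lN).
exists (i + j)%N; have [k] := ubnP (i + j).
elim: k i j v w iv jw => // k IH [|i] [|j] v w.
- by move=> /= -> _ _; rewrite (lin0 (b1 _)).
- by move=> /= -> _ _; rewrite (lin0 (b1 _)) it0 (lin0 lN).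
- by move=> _ /= -> _; rewrite (lin0 (b2 _)) it0 (lin0 lN).
have itD m t t' : iter m N (t + t') = iter m N t + iter m N t'.
  by elim: m => //= m ->; rewrite (linD lN).
move=> iv jw; rewrite addSn ltnS => ij; rewrite iterSr NE itD.
rewrite IH ?add0r -?iterSr //.
by rewrite -addSnnS IH -?iterSr // addSnnS.
Qed.

(** The given decomposition of [xT] is compared with the derivations [S] and [N] built from the
    factors. Commutation and [xT = S + N] are checked on pure tensors through [tensor_ext]. *)
Lemma JC_tensor (L : closedFieldType) (iota : {rmorphism F -> L})
    (xV sV nV : V -> V) (xW sW nW : W -> W) (xT sT nT : T -> T) :
  lin sV -> lin nV -> lin sW -> lin nW -> lin sT -> lin nT ->
  JC_decomp iota xV sV nV -> JC_decomp iota xW sW nW -> JC_decomp iota xT sT nT ->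
  (forall v w, xT (b v w) = b (xV v) w + b v (xW w)) ->
  forall v w, sT (b v w) = b (sV v) w + b v (sW w).
Proof.
move=> lsV lnV lsW lnW lsT lnT [ssV nnV snV xEV] [ssW nnW snW xEW] [ssT nnT snT xET].
move=> xb v w.
have [bb _ _] := bT; have [b1 b2] := bb.
have [S [lS SE]] := tensor_derivation lsV lsW.
have [N [lN NE]] := tensor_derivation lnV lnW.
have SN t : S (N t) = N (S t).
  apply: (@tensor_ext T (S \o N) (N \o S)) => /= [a u u'|a u u'|u u'].
  - by rewrite /comp lN lS.
  - by rewrite /comp lS lN.
  rewrite NE SE (linD lS) (linD lN) !SE !NE snV snW -!addrA; congr (_ + _).
  by rewrite addrCA.
have xSN t : xT t = S t + N t.
  apply: (@tensor_ext T xT (fun t => S t + N t)) => [a u u'|a u u'|u u'].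
  - by rewrite !xET lsT lnT scalerDr addrACA.
  - by rewrite lS lN scalerDr addrACA.
  rewrite xb SE NE xEV xEW (linD (b1 _)) (linD (b2 _)).
  by rewrite addrACA.
rewrite -SE; symmetry.
apply: (@semisimple_intertwine F T T id xT S N xT sT nT) => //.
- exact: (tensor_separably_killed iota bb lsV lsW lS SE
    (semisimple_separably_killed v lsV ssV) (semisimple_separably_killed w lsW ssW)).
- exact: tensor_derivation_nilpotent NE (nnV v) (nnW w).
- exact: semisimple_separably_killed ssT.
Qed.

End Tensor.

(** * The monoid M and functionals on its coefficient functions *)

Section LieOfMonoid.
Variables (F : fieldType) (g : lmodType F) (br : g -> g -> g).
Variables (C : gmod br -> Prop) (du : forall V : gmod br, (V -> F) -> Prop).
Hypotheses (HC : good_cat C) (Hdu : dual_cat C du).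

Lemma in_M_id : in_M C du (fun V v => v).
Proof. by split=> //; split=> // V CV; split. Qed.

Lemma in_M_comp (m m' : gfamily br) : in_M C du m -> in_M C du m' ->
  in_M C du (fun V v => m V (m' V v)).
Proof.
move=> [[mE mN] mT m0] [[mE' mN'] mT' m0']; split.
- split=> [V CV|V W f CV CW hf v]; last first.
    by rewrite (mN _ _ _ CV CW hf) (mN' _ _ _ CV CW hf).
  have [[l d] [l' d']] := (mE V CV, mE' V CV); split=> [a u v|phi hphi].
    by rewrite l' l.
  exact: (d' _ (d _ hphi)).
- by move=> V W T b CV CW CT hb v w; rewrite (mT' V W) ?(mT V W).
- by move=> V0 CV hV v; rewrite m0' // m0.
Qed.

Lemma LieM_orbit (x : gfamily br) V phi v k : in_LieM C du x -> C V -> du phi ->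
  (forall m : Mset C du, fcoef phi v m = 0) -> phi (iter k (x V) v) = 0.
Proof.
move=> [_ _ _ [delta dE]] CV.
have [/(_ V CV)[_ du0 _ _] _ _ _ _] := Hdu.
elim: k v phi => [|k IH] v phi hphi fv0.
  exact: (fv0 (exist _ _ in_M_id)).
rewrite iterSr; apply: IH => // -[m hm]; rewrite /fcoef /=.
have [[mE _] _ _] := hm; have [_ mdu] := mE V CV.
have hphim := mdu _ hphi.
rewrite -(dE V (fun v => phi (m V v)) v CV hphim).
(* At [m'] the left side is the coefficient of [phi] at the composite of [m] and [m'], again a
   member of M, so it vanishes. *)
have -> : fcoef (fun v => phi (m V v)) v = fcoef (C := C) (du := du) (fun _ : V => 0) v.
  apply: functional_extensionality => -[m' hm'].
  exact: (fv0 (exist _ _ (in_M_comp hm hm'))).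
by rewrite dE.
Qed.

Lemma LieM_functional_of_polynomial (x s : gfamily br) : in_LieM C du x -> in_Nat C du s ->
  (forall V, C V -> forall v, exists P, s V v = polyact (x V) P v) ->
  exists delta : (Mset C du -> F) -> F,
    forall (V : gmod br) phi v, C V -> du phi -> delta (fcoef phi v) = phi (s V v).
Proof.
move=> Hx [sE sN] sP.
pose R (f : Mset C du -> F) a := exists V phi v,
  [/\ C V, du phi, f = fcoef phi v & a = phi (s V v)].
(* [epsilon] picks a value from some representation of [f] as a coefficient and is arbitrary off
   F[M]. What remains is independence of the representation. *)
exists (fun f => epsilon (inhabits 0) (R f)) => V phi v CV hphi.
have : R (fcoef phi v) (epsilon (inhabits 0) (R (fcoef phi v))).
  by apply: epsilon_spec; exists (phi (s V v)), V, phi, v.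
case=> W [psi [w [CW hpsi fE ->]]].
have [_ _ hsum _ _] := HC; have [S [CS [i1 [i2 [p1 [p2 dS]]]]]] := hsum V W CV CW.
have [_ [mp1 mp2] [ip1 ip2 pi21 pi12] _] := dS.
have [hdu _ dumor _ _] := Hdu; have [dulin _ ducomb _] := hdu S CS.
(* Two representations of one function become a single pair [Phi], [u] on the direct sum, whose
   coefficient vanishes on M. *)
pose Phi t := -1 * psi (p2 t) + phi (p1 t).
have hPhi : du Phi by apply: ducomb; [exact: dumor mp2 hpsi | exact: dumor mp1 hphi].
pose u := i1 v + i2 w.
have p1u : p1 u = v by rewrite (linD mp1.1) ip1 pi12 addr0.
have p2u : p2 u = w by rewrite (linD mp2.1) ip2 pi21 add0r.
have Phi0 k : Phi (iter k (x S) u) = 0.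
  apply: LieM_orbit => // m; have [[_ mN] _ _] := proj2_sig m.
  rewrite /fcoef /Phi (mN _ _ _ CS CV mp1) (mN _ _ _ CS CW mp2) p1u p2u.
  by rewrite -[phi _]/(fcoef phi v m) fE mulN1r addNr.
have lPhi := dulin _ hPhi.
(* One [P] for [u] handles both components at once: [Phi] kills the [x]-orbit of [u], hence
   [s S u]. *)
have [P sSu] := sP S CS u.
have : Phi (s S u) = 0.
  have Phi00 : Phi 0 = 0 by have := lPhi (-1) 0 0; rewrite scaler0 addr0 mulN1r addNr.
  rewrite sSu /polyact; elim/big_rec: _ => // i t _ t0.
  by rewrite lPhi Phi0 t0 mulr0 addr0.
rewrite /Phi (sN _ _ _ CS CV mp1) (sN _ _ _ CS CW mp2) p1u p2u mulN1r addrC.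
by move/eqP; rewrite subr_eq0 => /eqP.
Qed.

End LieOfMonoid.

(** * Membership of both parts in Lie(M), and uniqueness *)

Theorem theorem2p17
  (F : fieldType) (Hchar : [pchar F] =i pred0)
  (* an algebraic closure of F *)
  (L : closedFieldType) (iota : {rmorphism F -> L})
  (Halg : forall z : L, exists p : {poly F}, p != 0 /\ root (map_poly iota p) z)
  (* the Lie algebra *)
  (g : lmodType F) (br : g -> g -> g) (Hbr : lie_bracket br)
  (* the category C and its category of duals *)
  (C : gmod br -> Prop) (HC : good_cat C)
  (du : forall V : gmod br, (V -> F) -> Prop) (Hdu : dual_cat C du)
  (x : gfamily br) (Hx : in_LieM C du x)
  (Hxlf : forall V, C V -> locally_finite (x V))
  (s n : gfamily br)
  (Hsn : forall V, C V ->
     [/\ JC_decomp iota (x V) (s V) (n V), End_du du (s V) & End_du du (n V)]) :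
  [/\ in_LieM C du s /\ (forall V, C V -> semisimple_op iota (s V)),
      in_LieM C du n /\ (forall V, C V -> locally_nilpotent (n V)),
      (forall V, C V -> forall v, x V v = s V v + n V v),
      (forall V, C V -> forall v, s V (n V v) = n V (s V v))
    & forall s' n' : gfamily br,
        in_LieM C du s' -> (forall V, C V -> semisimple_op iota (s' V)) ->
        in_LieM C du n' -> (forall V, C V -> locally_nilpotent (n' V)) ->
        (forall V, C V -> forall v, x V v = s' V v + n' V v) ->
        (forall V, C V -> forall v, s' V (n' V v) = n' V (s' V v)) ->
        forall V, C V -> forall v, s' V v = s V v /\ n' V v = n V v].
Proof.
have lsn V : C V -> lin (s V) /\ lin (n V) by move=> /Hsn[_ [ls _] [ln _]].
have JC V (CV : C V) : JC_decomp iota (x V) (s V) (n V) by have [] := Hsn V CV.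
have xsn V (CV : C V) v : x V v = s V v + n V v by have [_ _ _ ->] := JC V CV.
(* Writing [n] as [x - s] lets naturality, the derivation rule, vanishing on trivial modules and the
   functional for [n] follow by subtraction. *)
have nE V (CV : C V) v : n V v = x V v - s V v by rewrite xsn // addrC addKr.
have [[xE xN] xT x0 [dx dxE]] := Hx.
have sN : in_Nat C du s.
  split=> [V CV|V W f CV CW [lf mf] v]; first by have [] := Hsn V CV.
  have [[lsV lnV] [lsW lnW]] := (lsn V CV, lsn W CW).
  apply: (JC_intertwine (iota := iota) lf lsV lnV lsW lnW (JC V CV) (JC W CW)).
  exact: xN.
have sT (V W T : gmod br) b : C V -> C W -> C T -> @is_tensor _ _ _ V W T b ->
    forall v w, s T (b v w) = b (s V v) w + b v (s W w).
  move=> CV CW CT bT.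
  have [[lsV lnV] [lsW lnW] [lsT lnT]] := And3 (lsn V CV) (lsn W CW) (lsn T CT).
  apply: (JC_tensor bT lsV lnV lsW lnW lsT lnT (JC V CV) (JC W CW) (JC T CT)).
  exact: xT.
have s0 V0 : C V0 -> trivial1 V0 -> forall v, s V0 v = 0.
  move=> CV tV; have [ls ln] := lsn V0 CV.
  apply: (JC_of_zero (iota := iota) ls ln).
  have [ss nn sn xE'] := JC V0 CV; split=> // v.
  by rewrite -xE' x0.
have [ds dsE] : exists delta : (Mset C du -> F) -> F,
    forall (V : gmod br) phi v, C V -> du V phi -> delta (fcoef phi v) = phi (s V v).
  apply: (LieM_functional_of_polynomial HC Hdu Hx sN) => V CV.
  by have [ls ln] := lsn V CV; exact: (JC_polynomial ls ln (JC V CV)).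
split.
- split; last by move=> V CV; have [] := JC V CV.
  by split=> //; exists ds.
- split; last by move=> V CV; have [] := JC V CV.
  split.
  + split=> [V CV|V W f CV CW mf v]; first by have [] := Hsn V CV.
    by rewrite !nE // (linB mf.1) (xN _ _ _ CV CW mf) (sN.2 _ _ _ CV CW mf).
  + move=> V W T b CV CW CT bT v w; have [[b1 b2] _ _] := bT.
    rewrite !nE // (xT V W) // (sT V W) // (linB (b1 _)) (linB (b2 _)).
    by rewrite opprD addrACA.
  + by move=> V0 CV tV v; rewrite nE // x0 // s0 // subrr.
  + exists (fun f => dx f - ds f) => V phi v CV hphi; rewrite dxE // dsE // nE //.
    have [hdu _ _ _ _] := Hdu; have [dlin _ _ _] := hdu V CV.
    have := dlin _ hphi (-1) (s V v) (x V v).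
    by rewrite scaleN1r addrC mulN1r addrC [in RHS]addrC => ->.
- exact: xsn.
- by move=> V CV; have [] := JC V CV.
move=> s' n' [[sE' _] _ _ _] ss' [[nE' _] _ _ _] nn' xE' sn' V CV v.
have [[ls ln] [ls' _] [ln' _]] := And3 (lsn V CV) (sE' V CV) (nE' V CV).
have JC' : JC_decomp iota (x V) (s' V) (n' V).
  by split; [exact: ss' | exact: nn' | exact: sn' | exact: xE'].
have ss : s' V v = s V v.
  by apply: (JC_intertwine (f := id) (iota := iota) _ ls' ln' ls ln JC' (JC V CV)).
by split=> //; apply: (addrI (s V v)); rewrite -xsn // xE' // ss.
Qed.
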